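(* Let $K$ be a field of characteristic $p>0$, let $L/K$ be a finite normal modular field extension of exponent less than or equal to $1$, let $V$ be a $K$-vector space, and let $L[\bar X]=L[X]/(X^p)$. Let $W$ be an $L$-linear subspace of $V_L=V\otimes_K L$. Then $W\subset V_L$ is defined over $K$ if and only if there exists an $L[\bar X]$-submodule $\tilde W$ of $V_{L[\bar X]}=V\otimes_K L[\bar X]$ such that: (i) $\tilde W$ is free as an $L[\bar X]$-module; (ii) $\tilde W$ is invariant under the natural $\mathrm{HG}(L/K)$-action on $V_{L[\bar X]}$; (iii) $\tilde W\otimes_{L[\bar X]}L=W$.
   Context: An algebraic extension $L/K$ is modular if it is isomorphic to a tensor product over $K$ of extensions of $K$ generated by one element. The exponent of $L/K$ is the smallest integer $n\ge 0$ such that $L^{p^n}$ is separable over $K$ (it is $0$ if $L/K$ is separable). Here $\bar X$ is the class of $X$, $K[\bar X]=K[X]/(X^p)$, and $\mathrm{HG}(L/K)=\operatorname{Aut}(L[\bar X]/K[\bar X])$ is the group of $K[\bar X]$-algebra automorphisms of $L[\bar X]$, acting on $V\otimes_K L[\bar X]$ by $\sigma(v\otimes a)=v\otimes\sigma(a)$. The subspace $W\subset V_L$ is defined over $K$ if there is a $K$-linear subspace $W_0\subset V$ with $W=W_0\otimes_K L$. In (iii), $L$ is the $L[\bar X]$-algebra $L[\bar X]/(\bar X)$, and the equality means that $\tilde W\otimes_{L[\bar X]}L$ is identified with $W$ via the natural map to $V_{L[\bar X]}\otimes_{L[\bar X]}L=V_L$. *)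

(* Defs.v *)
From HB Require Import structures.
From mathcomp Require Import all_boot all_order all_algebra all_field.
From mathcomp Require Import boolp.

Set Implicit Arguments.
Unset Strict Implicit.
Unset Printing Implicit Defensive.

Import GRing.Theory.
Local Open Scope ring_scope.
Local Open Scope quotient_scope.

(** For [iota : R -> S] a morphism of commutative rings and [M] an [R]-module,
    [tensor iota M] is the [S]-module M (x)_R S, with S an R-algebra via [iota].
    Its elements are finite formal sums of pure tensors, i.e. sequences of
    pairs, modulo the least congruence containing the usual relations. *)

Section Tensor.
Context {R S : comNzRingType} (iota : {rmorphism R -> S}) (M : lmodType R).
Implicit Types (x y z : M) (a b c : S) (r : R) (s t u : seq (M * S)).

Inductive tensor_rel : seq (M * S) -> seq (M * S) -> Prop :=
| tensor_rel_refl s : tensor_rel s s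
| tensor_rel_sym s t : tensor_rel s t -> tensor_rel t s
| tensor_rel_trans s t u : tensor_rel s t -> tensor_rel t u -> tensor_rel s u
| tensor_rel_cat s s' t t' :
    tensor_rel s s' -> tensor_rel t t' -> tensor_rel (s ++ t) (s' ++ t')
| tensor_rel_catC s t : tensor_rel (s ++ t) (t ++ s)
| tensor_rel_0l a : tensor_rel [:: (0, a)] [::]
| tensor_rel_Dl x y a : tensor_rel [:: (x + y, a)] [:: (x, a); (y, a)]
| tensor_rel_Dr x a b : tensor_rel [:: (x, a + b)] [:: (x, a); (x, b)]
| tensor_rel_Zl r x a : tensor_rel [:: (r *: x, a)] [:: (x, iota r * a)].

Definition tensor_relb s t : bool := `[< tensor_rel s t >].

Lemma tensor_relb_refl : reflexive tensor_relb.
Proof. by move=> s; apply/asboolP/tensor_rel_refl. Qed.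

Lemma tensor_relb_sym : symmetric tensor_relb.
Proof.
by move=> s t; apply/asboolP/asboolP => /tensor_rel_sym.
Qed.

Lemma tensor_relb_trans : transitive tensor_relb.
Proof.
move=> t s u /asboolP st /asboolP tu; apply/asboolP.
exact: tensor_rel_trans st tu.
Qed.

Canonical tensor_equiv :=
  EquivRel tensor_relb tensor_relb_refl tensor_relb_sym tensor_relb_trans.

Definition tensor := {eq_quot tensor_equiv}.
HB.instance Definition _ := Choice.on tensor.
HB.instance Definition _ := EqQuotient.on tensor.

Lemma eq_tensor s t : tensor_rel s t <-> \pi_tensor s = \pi_tensor t.
Proof.
by split=> [st | /eqmodP/asboolP //]; apply/eqmodP/asboolP.
Qed.

Lemma repr_tensor s : tensor_rel (repr (\pi_tensor s)) s.
Proof. by apply/eq_tensor; rewrite reprK. Qed.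

Lemma tensor_ind (P : tensor -> Prop) :
  (forall s, P (\pi_tensor s)) -> forall v, P v.
Proof. by move=> Ppi v; rewrite -[v]reprK. Qed.

Definition tens x a : tensor := \pi_tensor [:: (x, a)].

Definition tensor_add (v w : tensor) : tensor := \pi_tensor (repr v ++ repr w).
Definition tensor_opp (v : tensor) : tensor :=
  \pi_tensor [seq (- xa.1, xa.2) | xa <- repr v].
Definition tensor_scale c (v : tensor) : tensor :=
  \pi_tensor [seq (xa.1, c * xa.2) | xa <- repr v].

Lemma tensor_rel_map (f : M * S -> M * S) :
  (forall a, tensor_rel [:: f (0, a)] [::]) ->
  (forall x y a, tensor_rel [:: f (x + y, a)] [:: f (x, a); f (y, a)]) ->
  (forall x a b, tensor_rel [:: f (x, a + b)] [:: f (x, a); f (x, b)]) ->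
  (forall r x a, tensor_rel [:: f (r *: x, a)] [:: f (x, iota r * a)]) ->
  forall s t, tensor_rel s t -> tensor_rel (map f s) (map f t).
Proof.
move=> f0 fDl fDr fZ s t; elim=> {s t}.
- by move=> s; apply: tensor_rel_refl.
- by move=> s t _; apply: tensor_rel_sym.
- by move=> s t u _ st _ tu; apply: tensor_rel_trans st tu.
- by move=> s s' t t' _ ss' _ tt'; rewrite !map_cat; apply: tensor_rel_cat.
- by move=> s t; rewrite !map_cat; apply: tensor_rel_catC.
- by move=> a; apply: f0.
- by move=> x y a; apply: fDl.
- by move=> x a b; apply: fDr.
- by move=> r x a; apply: fZ.
Qed.

Lemma pi_tensor_add s t :
  tensor_add (\pi_tensor s) (\pi_tensor t) = \pi_tensor (s ++ t).
Proof. by apply/eq_tensor/tensor_rel_cat; apply: repr_tensor. Qed.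

Lemma pi_tensor_opp s :
  tensor_opp (\pi_tensor s) = \pi_tensor [seq (- xa.1, xa.2) | xa <- s].
Proof.
apply/eq_tensor; apply: tensor_rel_map (repr_tensor s) => /= [a|x y a|x a b|r x a].
- by rewrite oppr0; apply: tensor_rel_0l.
- by rewrite opprD; apply: tensor_rel_Dl.
- exact: tensor_rel_Dr.
- by rewrite -scalerN; apply: tensor_rel_Zl.
Qed.

Lemma pi_tensor_scale c s :
  tensor_scale c (\pi_tensor s) = \pi_tensor [seq (xa.1, c * xa.2) | xa <- s].
Proof.
apply/eq_tensor; apply: tensor_rel_map (repr_tensor s) => /= [a|x y a|x a b|r x a].
- exact: tensor_rel_0l.
- exact: tensor_rel_Dl.
- by rewrite mulrDr; apply: tensor_rel_Dr.
- by rewrite mulrCA; apply: tensor_rel_Zl.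
Qed.

Lemma tensor_addA : associative tensor_add.
Proof.
elim/tensor_ind=> s; elim/tensor_ind=> t; elim/tensor_ind=> u.
by rewrite !pi_tensor_add catA.
Qed.

Lemma tensor_addC : commutative tensor_add.
Proof.
elim/tensor_ind=> s; elim/tensor_ind=> t; rewrite !pi_tensor_add.
exact/eq_tensor/tensor_rel_catC.
Qed.

Lemma tensor_add0 : left_id (\pi_tensor [::]) tensor_add.
Proof. by elim/tensor_ind=> s; rewrite pi_tensor_add. Qed.

Lemma tensor_addN : left_inverse (\pi_tensor [::]) tensor_opp tensor_add.
Proof.
elim/tensor_ind=> s; rewrite pi_tensor_opp pi_tensor_add; apply/eq_tensor.
elim: s => [|[x a] s IHs] /=; first exact: tensor_rel_refl.
set s' := map _ s in IHs *.
rewrite -cat1s -[(x, a) :: s]cat1s -[[::]]/([::] ++ [::]).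
apply: (@tensor_rel_trans _ (([:: (- x, a)] ++ [:: (x, a)]) ++ (s' ++ s))).
  rewrite -!catA; apply: tensor_rel_cat; first exact: tensor_rel_refl.
  rewrite !catA; apply: tensor_rel_cat; last exact: tensor_rel_refl.
  exact: tensor_rel_catC.
apply: tensor_rel_cat IHs; apply: tensor_rel_trans (tensor_rel_0l a).
by rewrite -(addNr x); apply/tensor_rel_sym/tensor_rel_Dl.
Qed.

HB.instance Definition _ :=
  GRing.isZmodule.Build tensor tensor_addA tensor_addC tensor_add0 tensor_addN.

Lemma pi_tensorD s t : \pi_tensor s + \pi_tensor t = \pi_tensor (s ++ t).
Proof. exact: pi_tensor_add. Qed.

Lemma tensor_scaleA c b (v : tensor) :
  tensor_scale c (tensor_scale b v) = tensor_scale (c * b) v.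
Proof.
elim/tensor_ind: v => s; rewrite !pi_tensor_scale -map_comp; congr (\pi_tensor _).
by apply: eq_map => -[x a] /=; rewrite mulrA.
Qed.

Lemma tensor_scale1 : left_id 1 tensor_scale.
Proof.
elim/tensor_ind=> s; rewrite pi_tensor_scale; congr (\pi_tensor _).
by rewrite -[RHS]map_id; apply: eq_map => -[x a] /=; rewrite mul1r.
Qed.

Lemma tensor_scaleDr : right_distributive tensor_scale +%R.
Proof.
move=> c; elim/tensor_ind=> s; elim/tensor_ind=> t.
by rewrite pi_tensorD !pi_tensor_scale pi_tensorD map_cat.
Qed.

Lemma tensor_scaleDl (v : tensor) :
  {morph tensor_scale^~ v : a b / a + b >-> a + b}.
Proof.
elim/tensor_ind: v => s a b; rewrite !pi_tensor_scale pi_tensorD; apply/eq_tensor.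
elim: s => [|[x c] s IHs] /=; first exact: tensor_rel_refl.
set sab := map _ s in IHs *; set sa := map _ s in IHs *.
set sb := map _ s in IHs *.
rewrite -[_ :: sab]cat1s -[_ :: (sa ++ _)]cat1s -[_ :: sb]cat1s.
apply: (@tensor_rel_trans _
  (([:: (x, a * c)] ++ [:: (x, b * c)]) ++ (sa ++ sb))).
  by apply: tensor_rel_cat IHs; rewrite mulrDl; apply: tensor_rel_Dr.
rewrite -!catA; apply: tensor_rel_cat; first exact: tensor_rel_refl.
rewrite !catA; apply: tensor_rel_cat; last exact: tensor_rel_refl.
exact: tensor_rel_catC.
Qed.

HB.instance Definition _ :=
  GRing.Zmodule_isLmodule.Build S tensor
    tensor_scaleA tensor_scale1 tensor_scaleDr tensor_scaleDl.

Lemma tensorDl x y a : tens (x + y) a = tens x a + tens y a.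
Proof. by rewrite pi_tensorD; apply/eq_tensor/tensor_rel_Dl. Qed.

Lemma tensorDr x a b : tens x (a + b) = tens x a + tens x b.
Proof. by rewrite pi_tensorD; apply/eq_tensor/tensor_rel_Dr. Qed.

Lemma tensorZl r x a : tens (r *: x) a = tens x (iota r * a).
Proof. exact/eq_tensor/tensor_rel_Zl. Qed.

Lemma tensorZr c x a : c *: tens x a = tens x (c * a).
Proof. exact: pi_tensor_scale. Qed.

Lemma pi_tensorE s : \pi_tensor s = \sum_(xa <- s) tens xa.1 xa.2.
Proof.
elim: s => [|[x a] s IHs]; first by rewrite big_nil.
by rewrite big_cons -IHs pi_tensorD.
Qed.

Lemma tensorP (v : tensor) : exists s, v = \sum_(xa <- s) tens xa.1 xa.2.
Proof. by elim/tensor_ind: v => s; exists s; rewrite pi_tensorE. Qed.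

(** The map induced by a balanced biadditive map, computed on representatives;
    it is only meaningful when [h] is balanced (see [tensor_lift_tens]). *)

Definition balanced (Z : zmodType) (h : M -> S -> Z) : Prop :=
  [/\ forall x y a, h (x + y) a = h x a + h y a,
      forall x a b, h x (a + b) = h x a + h x b
    & forall r x a, h (r *: x) a = h x (iota r * a)].

Definition tensor_lift (Z : zmodType) (h : M -> S -> Z) (v : tensor) : Z :=
  \sum_(xa <- repr v) h xa.1 xa.2.

Section Lift.
Context (Z : zmodType) (h : M -> S -> Z) (hP : balanced h).

Lemma tensor_lift_pi s :
  tensor_lift h (\pi_tensor s) = \sum_(xa <- s) h xa.1 xa.2.
Proof.
have [hDl hDr hZ] := hP; have h0 a : h 0 a = 0.
  by apply: (addrI (h 0 a)); rewrite -hDl !addr0.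
rewrite /tensor_lift; move: (repr _) (repr_tensor s) => t0.
elim=> {t0 s}.
- by [].
- by move=> s t _ ->.
- by move=> s t u _ -> _ ->.
- by move=> s s' t t' _ ss' _ tt'; rewrite !big_cat /= ss' tt'.
- by move=> s t; rewrite !big_cat /= addrC.
- by move=> a; rewrite big_seq1 big_nil h0.
- by move=> x y a; rewrite !big_cons !big_nil !addr0 hDl.
- by move=> x a b; rewrite !big_cons !big_nil !addr0 hDr.
- by move=> r x a; rewrite !big_seq1 hZ.
Qed.

Lemma tensor_lift_tens x a : tensor_lift h (tens x a) = h x a.
Proof. by rewrite tensor_lift_pi big_seq1. Qed.

Lemma tensor_liftD (v w : tensor) :
  tensor_lift h (v + w) = tensor_lift h v + tensor_lift h w.
Proof.
elim/tensor_ind: v => s; elim/tensor_ind: w => t.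
by rewrite pi_tensorD !tensor_lift_pi big_cat.
Qed.

End Lift.

End Tensor.

(** id (x) phi : M (x)_R S -> M (x)_R S', for [phi] a morphism of R-algebras. *)

Definition tensor_mapr (R S S' : comNzRingType) (iota : {rmorphism R -> S})
    (iota' : {rmorphism R -> S'}) (M : lmodType R) (phi : S -> S') :
    tensor iota M -> tensor iota' M :=
  tensor_lift (fun x a => tens iota' x (phi a)).

Lemma balanced_mapr (R S S' : comNzRingType) (iota : {rmorphism R -> S})
    (iota' : {rmorphism R -> S'}) (M : lmodType R) (phi : {rmorphism S -> S'}) :
    (forall r, phi (iota r) = iota' r) ->
  balanced iota (fun (x : M) a => tens iota' x (phi a)).
Proof.
move=> phiK; split=> [x y a|x a b|r x a]; first exact: tensorDl.
  by rewrite rmorphD tensorDr.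
by rewrite tensorZl rmorphM phiK.
Qed.

(** f (x) id : M (x)_R S -> N (x)_R S, for [f] an R-linear map. *)

Definition tensor_mapl (R S : comNzRingType) (iota : {rmorphism R -> S})
    (M N : lmodType R) (f : M -> N) : tensor iota M -> tensor iota N :=
  tensor_lift (fun x a => tens iota (f x) a).

Lemma balanced_mapl (R S : comNzRingType) (iota : {rmorphism R -> S})
    (M N : lmodType R) (f : {linear M -> N}) :
  balanced iota (fun (x : M) a => tens iota (f x) a).
Proof.
split=> [x y a|x a b|r x a]; first by rewrite linearD tensorDl.
  exact: tensorDr.
by rewrite linearZ tensorZl.
Qed.

(** The canonical map (M (x)_R S) (x)_S S' -> M (x)_R S'. *)

Definition tensor_assoc (R S S' : comNzRingType) (iota : {rmorphism R -> S})
    (phi : {rmorphism S -> S'}) (iota' : {rmorphism R -> S'}) (M : lmodType R) :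
    tensor phi (tensor iota M) -> tensor iota' M :=
  tensor_lift (fun v c => c *: tensor_mapr iota' phi v).

Lemma balanced_assoc (R S S' : comNzRingType) (iota : {rmorphism R -> S})
    (phi : {rmorphism S -> S'}) (iota' : {rmorphism R -> S'}) (M : lmodType R) :
    (forall r, phi (iota r) = iota' r) ->
  balanced phi
    (fun (v : tensor iota M) c => c *: tensor_mapr iota' phi v).
Proof.
move=> phiK; have hP := balanced_mapr M phiK.
split=> [v w c|v c d|b v c].
- by rewrite [tensor_mapr _ _ _]tensor_liftD // scalerDr.
- by rewrite scalerDl.
- rewrite mulrC -scalerA; congr (_ *: _).
  move: v; apply: tensor_ind => s.
  rewrite [_ *: _]pi_tensor_scale /tensor_mapr !tensor_lift_pi // big_map.
  by rewrite scaler_sumr; apply: eq_bigr => xa _; rewrite rmorphM tensorZr.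
Qed.

Section Submodule.
Context (R : pzRingType) (M : lmodType R) (W : submodClosed M).

Record submod : predArgType := Submod { submod_val :> M; _ : submod_val \in W }.

HB.instance Definition _ := [isSub for submod_val].
HB.instance Definition _ := [Choice of submod by <:].
HB.instance Definition _ := [SubChoice_isSubLmodule of submod by <:].

Lemma submod_val_is_linear : linear submod_val.
Proof. exact: (linearP (val : {linear submod -> M})). Qed.

HB.instance Definition _ :=
  GRing.isLinear.Build R submod M *:%R submod_val submod_val_is_linear.

End Submodule.

Definition free_module (R : nzRingType) (M : lmodType R) : Prop :=
  exists B : {pred M},
    (forall x : M, exists (s : seq M) (c : M -> R),
        {subset s <= B} /\ x = \sum_(b <- s) c b *: b) /\
    (forall (s : seq M) (c : M -> R), uniq s -> {subset s <= B} ->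
        \sum_(b <- s) c b *: b = 0 -> forall b, b \in s -> c b = 0).

(** Equalities of the form "T = W", for a tensor product T with a natural map
    [f] to the ambient module of W, mean that [f] is a bijection onto W. *)
Definition identifies (M N : Type) (f : M -> N) (W : {pred N}) : Prop :=
  injective f /\ forall y, y \in W <-> exists x, f x = y.

Definition defined_over (R S : comNzRingType) (iota : {rmorphism R -> S})
    (M : lmodType R) (W : submodClosed (tensor iota M)) : Prop :=
  exists W0 : submodClosed M,
    identifies (tensor_mapl (iota := iota) (@submod_val R M W0)) W.

Definition normal_extension (K : fieldType) (L : fieldExtType K) : Prop :=
  forall f : {poly K}, irreducible_poly f ->
    (exists x : L, root (map_poly (in_alg L) f) x) ->
    exists rs : seq L, map_poly (in_alg L) f %= \prod_(x <- rs) ('X - x%:P).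

(** The least n such that the elements of L^(p^n) are separable over K. *)
Definition is_exponent (p : nat) (K : fieldType) (L : fieldExtType K)
    (n : nat) : Prop :=
  let sep m := forall x : L, separable_element 1 (x ^+ (p ^ m)) in
  sep n /\ forall m, (m < n)%N -> ~ sep m.

(** [dfwith e x] replaces the i-th component of [e] by [x : E i]. *)
Definition multilinear (K : fieldType) (n : nat) (E : 'I_n -> lmodType K)
    (U : lmodType K) (mu : (forall i, E i) -> U) : Prop :=
  forall (e : forall i, E i) (i : 'I_n), linear (fun x : E i => mu (dfwith e x)).

Definition is_tensor_product (K : fieldType) (n : nat) (E : 'I_n -> lmodType K)
    (T : lmodType K) (tau : (forall i, E i) -> T) : Prop :=
  multilinear tau /\
  forall (U : lmodType K) (mu : (forall i, E i) -> U), multilinear mu ->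
    exists g : {linear T -> U}, (forall e, g (tau e) = mu e) /\
      forall g' : {linear T -> U}, (forall e, g' (tau e) = mu e) -> g' =1 g.

Definition simple_extension (K : fieldType) (E : fieldExtType K) : Prop :=
  exists x : E, <<1; x>>%VS = fullv.

(** [L] is the tensor product of the [E i] as a K-algebra: the structure maps
    are algebra morphisms, and the induced multilinear map is universal.  As L
    has finite degree, finitely many factors of finite degree suffice. *)
Definition modular_extension (K : fieldType) (L : fieldExtType K) : Prop :=
  exists (n : nat) (E : 'I_n -> fieldExtType K)
         (j : forall i, {lrmorphism E i -> L}),
    (forall i, simple_extension (E i)) /\
    is_tensor_product (E := fun i => E i : lmodType K)
      (fun e => \prod_(i < n) j i (e i)).

(** This is R[X]/(X^p) for p > 0 only: [{poly %/ 1}] is R[X]/(X). *)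
Notation trunc R p := {poly %/ ('X^p : {poly R})}.

Section Trunc.
Context (R : comNzRingType) (p : nat).

(** The quotient map R[X]/(X^p) -> R[X]/(X) = R. *)
Definition trunc_coef0 (f : trunc R p) : R := (f : {poly R})`_0.

Lemma trunc_coef0_is_zmod_morphism : zmod_morphism trunc_coef0.
Proof. by move=> f g; rewrite /trunc_coef0 /= coefB. Qed.

Lemma coef0_rmodp_Xn (u : {poly R}) :
  (Pdiv.CommonRing.rmodp u (mk_monic 'X^p))`_0 = u`_0.
Proof.
rewrite mk_monic_Xn [in RHS](Pdiv.RingMonic.rdivp_eq (monicXn R p.-1.+1) u).
by rewrite coefD exprSr mulrA coefMX eqxx add0r.
Qed.

Lemma trunc_coef0_is_monoid_morphism : monoid_morphism trunc_coef0.
Proof.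
split=> [|f g]; first by rewrite /trunc_coef0 /= coefC.
by rewrite /trunc_coef0 poly_of_qpolyM coef0_rmodp_Xn coef0M.
Qed.

HB.instance Definition _ :=
  GRing.isZmodMorphism.Build (trunc R p) R trunc_coef0
    trunc_coef0_is_zmod_morphism.
HB.instance Definition _ :=
  GRing.isMonoidMorphism.Build (trunc R p) R trunc_coef0
    trunc_coef0_is_monoid_morphism.

Lemma trunc_coef0C (a : R) : trunc_coef0 (qpolyC _ a) = a.
Proof. by rewrite /trunc_coef0 /= coefC. Qed.

End Trunc.

Arguments trunc_coef0 {R} p f.

Definition trunc_map (R S : comNzRingType) (f : {rmorphism R -> S}) (p : nat)
    (a : trunc R p) : trunc S p :=
  in_qpoly 'X^p (map_poly f (a : {poly R})).

(** Membership in HG(L/K) = Aut (L[X]/(X^p) / K[X]/(X^p)). *)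
Definition in_HG (p : nat) (K : fieldType) (L : fieldExtType K)
    (sigma : {rmorphism trunc L p -> trunc L p}) : Prop :=
  bijective sigma /\
  forall a : trunc K p,
    sigma (trunc_map (in_alg L) a) = trunc_map (in_alg L) a.

(** The structure maps of [L] and of L[X]/(X^p) as K-algebras, and the
    resulting scalar extensions of a K-vector space. *)
Definition toL (K : fieldType) (L : fieldExtType K) : {rmorphism K -> L} :=
  in_alg L.
Definition toLX (p : nat) (K : fieldType) (L : fieldExtType K) :
    {rmorphism K -> trunc L p} :=
  qpolyC 'X^p \o in_alg L.

Notation ext_L L V := (tensor (toL L) V).
Notation ext_LX p L V := (tensor (toLX p L) V).

Definition HG_act (p : nat) (K : fieldType) (L : fieldExtType K)
    (V : lmodType K) (sigma : {rmorphism trunc L p -> trunc L p}) :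
    ext_LX p L V -> ext_LX p L V :=
  tensor_mapr (toLX p L) sigma.

Definition HG_invariant (p : nat) (K : fieldType) (L : fieldExtType K)
    (V : lmodType K) (Wt : {pred ext_LX p L V}) : Prop :=
  forall sigma : {rmorphism trunc L p -> trunc L p}, in_HG sigma ->
    forall v, v \in Wt -> HG_act sigma v \in Wt.

(** The natural map Wt (x)_{L[X]/(X^p)} L -> V_{L[X]/(X^p)} (x) L = V_L. *)
Definition reduction (p : nat) (K : fieldType) (L : fieldExtType K)
    (V : lmodType K) (Wt : submodClosed (ext_LX p L V)) :
    tensor (trunc_coef0 p) (submod Wt) -> ext_L L V :=
  fun t => tensor_assoc (toL L)
    (tensor_mapl (iota := trunc_coef0 p) (@submod_val _ _ Wt) t).

(* Main.v *)
Require Import Defs.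
From HB Require Import structures.
From mathcomp Require Import all_boot all_order all_algebra all_field.
From mathcomp Require Import boolp classical_sets.
Import GRing.Theory.
Local Open Scope ring_scope.

(** Why the theorem holds.

    Write V_S for the scalar extension of V to a K-algebra S.  If W comes from
    a K-subspace W0, then W0 extended to L[X]/(X^p) is a lift of W: it is free
    on any K-basis of W0, and it is preserved by every automorphism over
    K[X]/(X^p) because such an automorphism fixes K.

    Conversely let Wt be an invariant lift of W.  The identification of Wt mod
    X with W amounts to two facts ([identifies_reductionP]): W is the image of
    Wt under X = 0, and an element of Wt killed by X = 0 is X times an element
    of Wt.  A ring morphism phi : L -> L[X]/(X^p) over K whose constant term is
    bijective extends to an element sigma of HG(L/K) fixing X
    ([HG_extension]).  Two kinds of phi are used.  If phi is an automorphism s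
    of L, then setting X = 0 shows that id (x) s preserves W
    ([stable_automorphism]).  If phi (a) = a + D(a) X + ..., then for w in Wt
    the difference sigma(w) - w lies in Wt and vanishes at X = 0, so it is X z
    with z in Wt; comparing coefficients of X, the value of z at X = 0, which
    lies in W, is the image under id (x) D of the value of w.  Hence
    id (x) D preserves W ([stable_infinitesimal]).

    So W is stable under a set of operators on L that contains the
    multiplications, all K-automorphisms of L and all such derivations D.  The
    elements of L that commute with all of them are those of K: a separable
    element outside K is moved by an automorphism, as L is normal
    ([separable_moved]), and an inseparable x satisfies D x = 1 for some D.
    For the latter, a maximal subfield F over which x is inseparable satisfies
    L = F(x), since L^p is separable over K ([maximal_inseparable_subfield]);
    as the minimal polynomial of x over F is a polynomial in X^p, the
    substitution of x + X for x is a well-defined phi on L = F(x)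
    ([inseparable_infinitesimal]).

    By the density theorem ([jacobson_density]) the stabilizer of W then
    contains, for each vector of a K-basis of L, an operator sending this
    vector to 1 and the others to 0.  Applied to an element of W these
    operators extract its coordinates in V, so the coordinates lie in W and W
    is spanned by its K-rational vectors ([stable_defined_over]). *)

Set Implicit Arguments.
Unset Strict Implicit.
Unset Printing Implicit Defensive.

(** * Functoriality of scalar extension *)

(** R-linearity of a map between two R-algebras, each given by its structure
    morphism rather than as a module over R. *)
Definition scalar_linear (R S S' : comNzRingType) (iota : {rmorphism R -> S})
    (iota' : {rmorphism R -> S'}) (T : S -> S') : Prop :=
  (forall a b, T (a + b) = T a + T b) /\
  (forall r a, T (iota r * a) = iota' r * T a).

Lemma scalar_linear_comp (R S S' S'' : comNzRingType)
    (iota : {rmorphism R -> S}) (iota' : {rmorphism R -> S'})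
    (iota'' : {rmorphism R -> S''}) (T : S -> S') (T' : S' -> S'') :
    scalar_linear iota iota' T -> scalar_linear iota' iota'' T' ->
  scalar_linear iota iota'' (T' \o T).
Proof.
by move=> [TD TZ] [TD' TZ']; split=> [a b|r a] /=; rewrite ?TD ?TZ ?TD' ?TZ'.
Qed.

Section TensorMapr.
Context (R S S' : comNzRingType).
Context (iota : {rmorphism R -> S}) (iota' : {rmorphism R -> S'}).
Context (M : lmodType R).

Lemma scalar_linear_rmorphism (f : {rmorphism S -> S'}) :
  (forall r, f (iota r) = iota' r) -> scalar_linear iota iota' f.
Proof. by move=> fK; split=> [a b|r a]; rewrite ?rmorphD ?rmorphM ?fK. Qed.

Lemma balanced_scalar_linear (T : S -> S') : scalar_linear iota iota' T ->
  balanced iota (fun (x : M) a => tens iota' x (T a)).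
Proof.
move=> [TD TZ]; split=> [x y a|x a b|r x a]; first exact: tensorDl.
  by rewrite TD tensorDr.
by rewrite tensorZl TZ.
Qed.

Lemma tensor_mapr_sum (T : S -> S') (s : seq (M * S)) :
    scalar_linear iota iota' T ->
  tensor_mapr iota' T (\sum_(xa <- s) tens iota xa.1 xa.2) =
  \sum_(xa <- s) tens iota' xa.1 (T xa.2).
Proof.
move=> /balanced_scalar_linear balT.
by rewrite -pi_tensorE /tensor_mapr tensor_lift_pi.
Qed.

Lemma tensor_maprD (T : S -> S') (v w : tensor iota M) :
    scalar_linear iota iota' T ->
  tensor_mapr iota' T (v + w) = tensor_mapr iota' T v + tensor_mapr iota' T w.
Proof. by move=> linT; apply/tensor_liftD/balanced_scalar_linear. Qed.

Lemma tensor_maprB (T : S -> S') (v w : tensor iota M) :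
    scalar_linear iota iota' T ->
  tensor_mapr iota' T (v - w) = tensor_mapr iota' T v - tensor_mapr iota' T w.
Proof.
move=> linT; apply: (addIr (tensor_mapr iota' T w)).
by rewrite -tensor_maprD // !subrK.
Qed.

Lemma tensor_mapr_add (T T' : S -> S') (v : tensor iota M) :
    scalar_linear iota iota' T -> scalar_linear iota iota' T' ->
  tensor_mapr iota' (fun a => T a + T' a) v =
  tensor_mapr iota' T v + tensor_mapr iota' T' v.
Proof.
move=> linT linT'.
have linTT' : scalar_linear iota iota' (fun a => T a + T' a).
  have [[TD TZ] [TD' TZ']] := (linT, linT').
  by split=> [a b|r a]; rewrite ?TD ?TD' ?TZ ?TZ' ?mulrDr // addrACA.
have [s ->] := tensorP v; rewrite !tensor_mapr_sum // -big_split.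
by apply: eq_bigr => xa _; rewrite tensorDr.
Qed.

Lemma eq_tensor_mapr (T T' : S -> S') (v : tensor iota M) :
  T =1 T' -> tensor_mapr iota' T v = tensor_mapr iota' T' v.
Proof. by move=> eqT; apply: eq_bigr => xa _; rewrite eqT. Qed.

End TensorMapr.

Lemma tensor_mapr_comp (R S S' S'' : comNzRingType) (iota : {rmorphism R -> S})
    (iota' : {rmorphism R -> S'}) (iota'' : {rmorphism R -> S''})
    (M : lmodType R) (T : S -> S') (T' : S' -> S'') (v : tensor iota M) :
    scalar_linear iota iota' T -> scalar_linear iota' iota'' T' ->
  tensor_mapr iota'' T' (tensor_mapr iota' T v) =
  tensor_mapr iota'' (T' \o T) v.
Proof.
move=> linT linT'; have linT'T := scalar_linear_comp linT linT'.
have [s ->] := tensorP v; rewrite !tensor_mapr_sum //.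
by rewrite -(big_map (fun xa => (xa.1, T xa.2)) xpredT
  (fun xa => tens iota' xa.1 xa.2)) tensor_mapr_sum // big_map.
Qed.

Section PureTensors.
Context (R S : comNzRingType) (iota : {rmorphism R -> S}).
Implicit Types M N : lmodType R.

Lemma tens0r M (x : M) : tens iota x 0 = 0.
Proof. by apply: (addrI (tens iota x 0)); rewrite -tensorDr !addr0. Qed.

Lemma tens0l M a : tens iota (0 : M) a = 0.
Proof. by apply: (addrI (tens iota 0 a)); rewrite -tensorDl !addr0. Qed.

Lemma tens_sumr M (x : M) I (r : seq I) (F : I -> S) :
  tens iota x (\sum_(i <- r) F i) = \sum_(i <- r) tens iota x (F i).
Proof. exact: (big_morph _ (tensorDr iota x) (tens0r x)). Qed.

Lemma tens_suml M I (r : seq I) (F : I -> M) (a : S) :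
  tens iota (\sum_(i <- r) F i) a = \sum_(i <- r) tens iota (F i) a.
Proof.
exact: (big_morph (fun x : M => tens iota x a)
  (fun x y => tensorDl iota x y a) (tens0l M a)).
Qed.

Lemma scalar_linear_mul c : scalar_linear iota iota ( *%R c).
Proof. by split=> [a b|r a]; rewrite ?mulrDr // mulrCA. Qed.

Lemma scale_tensor_mapr M c (v : tensor iota M) :
  c *: v = tensor_mapr iota ( *%R c) v.
Proof.
have linc := scalar_linear_mul c.
have [s ->] := tensorP v; rewrite tensor_mapr_sum //.
by rewrite scaler_sumr; apply: eq_bigr => xa _; rewrite tensorZr.
Qed.

Lemma tensor_mapl_sum M N (f : {linear M -> N}) (s : seq (M * S)) :
  tensor_mapl f (\sum_(xa <- s) tens iota xa.1 xa.2) =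
  \sum_(xa <- s) tens iota (f xa.1) xa.2.
Proof.
by rewrite -pi_tensorE /tensor_mapl tensor_lift_pi //; apply: balanced_mapl.
Qed.

End PureTensors.

(** * Slices *)

Section Slice.
Context (R S : comNzRingType) (iota : {rmorphism R -> S}).
Implicit Types (M N : lmodType R) (l : S -> R).

(** The contraction V (x) S -> V of the second factor by a functional on S. *)
Definition slice M l : tensor iota M -> M := tensor_lift (fun x a => l a *: x).

Lemma balanced_slice M l : scalar_linear iota idfun l ->
  balanced iota (fun (x : M) a => l a *: x).
Proof.
move=> [lD lZ]; split=> [x y a|x a b|r x a]; first exact: scalerDr.
  by rewrite lD scalerDl.
by rewrite lZ scalerA mulrC.
Qed.

Lemma slice_sum M l (s : seq (M * S)) : scalar_linear iota idfun l ->
  slice l (\sum_(xa <- s) tens iota xa.1 xa.2) = \sum_(xa <- s) l xa.2 *: xa.1.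
Proof.
move=> /balanced_slice ball.
by rewrite -pi_tensorE /slice tensor_lift_pi.
Qed.

Lemma slice_mapl M N (f : {linear M -> N}) l (v : tensor iota M) :
  scalar_linear iota idfun l -> slice l (tensor_mapl f v) = f (slice l v).
Proof.
move=> linl; have [s ->] := tensorP v; rewrite tensor_mapl_sum slice_sum //.
rewrite -(big_map (fun xa => (f xa.1, xa.2)) xpredT
  (fun xa => tens iota xa.1 xa.2)) slice_sum // big_map linear_sum.
by apply: eq_bigr => xa _; rewrite linearZ.
Qed.

(** Here e is a basis of S, and l its dual basis. *)
Lemma slice_decomposition M (m : nat) (e : 'I_m -> S) (l : 'I_m -> S -> R)
    (v : tensor iota M) :
    (forall j, scalar_linear iota idfun (l j)) ->
    (forall a, a = \sum_j iota (l j a) * e j) ->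
  v = \sum_j tens iota (slice (l j) v) (e j).
Proof.
move=> linl le; have [s ->] := tensorP v.
under [RHS]eq_bigr => j _ do rewrite slice_sum // tens_suml.
rewrite exchange_big; apply: eq_bigr => xa _.
by rewrite [in LHS](le xa.2) tens_sumr; apply: eq_bigr => j _; rewrite tensorZl.
Qed.
End Slice.

(** * Subspaces obtained by base change *)

Section BaseChange.
Context (R S : comNzRingType) (iota : {rmorphism R -> S}) (M : lmodType R).
Context (W0 : submodClosed M).

(** The image of W0 (x) S in M (x) S. *)
Definition base_change : {pred tensor iota M} := fun v =>
  `[< exists2 s : seq (M * S), {in s, forall xa, xa.1 \in W0}
        & v = \sum_(xa <- s) tens iota xa.1 xa.2 >].

Lemma base_changeP v :
  v \in base_change <->
  exists2 s : seq (M * S), {in s, forall xa, xa.1 \in W0}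
    & v = \sum_(xa <- s) tens iota xa.1 xa.2.
Proof. by split=> /asboolP. Qed.

Lemma base_change_submod_closed : submod_closed base_change.
Proof.
split=> [|c v w]; first by apply/base_changeP; exists [::]; rewrite ?big_nil.
move=> /base_changeP[s sW0 ->] /base_changeP[t tW0 ->]; apply/base_changeP.
exists ([seq (xa.1, c * xa.2) | xa <- s] ++ t).
  by move=> xa; rewrite mem_cat => /orP[/mapP[yb /sW0 ? ->]|/tW0].
rewrite big_cat big_map scaler_sumr; congr (_ + _).
by apply: eq_bigr => xa _; rewrite tensorZr.
Qed.

HB.instance Definition _ :=
  GRing.isSubmodClosed.Build S (tensor iota M) base_change
    base_change_submod_closed.

Lemma tens_base_change x a : x \in W0 -> tens iota x a \in base_change.
Proof.
move=> W0x; apply/base_changeP; exists [:: (x, a)]; last by rewrite big_seq1.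
by move=> xa; rewrite inE => /eqP->.
Qed.

Lemma base_change_image v : v \in base_change <->
  exists w : tensor iota (submod W0), tensor_mapl (@submod_val _ _ W0) w = v.
Proof.
split=> [/base_changeP[s sW0 ->]|[w <-]]; last first.
  have [s ->] := tensorP w; rewrite tensor_mapl_sum; apply/base_changeP.
  exists [seq (val xa.1, xa.2) | xa <- s]; last by rewrite big_map.
  by move=> _ /mapP[xa _ ->]; apply: (valP xa.1).
elim: s sW0 => [|[x a] s IHs] sW0.
  exists 0; have := tensor_mapl_sum iota (@submod_val _ _ W0) [::].
  by rewrite !big_nil.
case: IHs => [xa xas|w wE]; first by apply: sW0; rewrite inE xas orbT.
have W0x : x \in W0 by apply: (sW0 (x, a)); rewrite mem_head.
exists (tens iota (Submod W0x) a + w); rewrite big_cons -wE.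
rewrite [LHS]tensor_liftD; last exact: balanced_mapl.
by congr (_ + _); apply: tensor_lift_tens; apply: balanced_mapl.
Qed.

End BaseChange.

Arguments base_change {R S} iota {M} W0 _.

Lemma base_change_mapr (R S S' : comNzRingType) (iota : {rmorphism R -> S})
    (iota' : {rmorphism R -> S'}) (M : lmodType R) (W0 : submodClosed M)
    (T : S -> S') v :
    scalar_linear iota iota' T -> v \in base_change iota W0 ->
  tensor_mapr iota' T v \in base_change iota' W0.
Proof.
move=> linT /base_changeP[s sW0 ->]; rewrite tensor_mapr_sum // big_seq.
by apply: rpred_sum => xa /sW0; apply: tens_base_change.
Qed.

(** * Bases *)

(** Collecting equal vectors turns a combination indexed by coefficient-vector
    pairs into the form, indexed by vectors, that [free_module] asks for. *)
Lemma sum_gather (R : nzRingType) (M : lmodType R) (r : seq (R * M)) :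
  \sum_(ab <- r) ab.1 *: ab.2 =
  \sum_(b <- undup (unzip2 r)) (\sum_(ab <- r | ab.2 == b) ab.1) *: b.
Proof.
under [RHS]eq_bigr => b _ do rewrite scaler_suml.
rewrite (exchange_big_dep xpredT) //=; apply: eq_big_seq => ab r_ab.
have uab : ab.2 \in undup (unzip2 r) by rewrite mem_undup map_f.
rewrite -big_filter (_ : [seq _ <- _ | _] = [:: ab.2]) ?big_seq1 //.
have := filter_pred1_uniq (undup_uniq (unzip2 r)) uab => <-.
by apply: eq_filter => b /=; rewrite eq_sym.
Qed.

(** A maximal independent set, given by Zorn's lemma, generates: in a nontrivial
    relation between its elements and a further vector x, the coefficient of x
    is nonzero. *)
Lemma vector_space_free (K : fieldType) (M : lmodType K) : free_module M.
Proof.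
pose indep (B : set M) := forall (s : seq M) (c : M -> K), uniq s ->
  (forall b, b \in s -> B b) -> \sum_(b <- s) c b *: b = 0 ->
  forall b, b \in s -> c b = 0.
have [F Findep totF|B [indepB maxB]] := @Zorn_bigcup M indep.
  move=> s c uniqs sF s0 b sb.
  suff [X FX sX] : exists2 X, F X & forall b, b \in s -> X b.
    by apply: (Findep X FX s c).
  have [X0 FX0 _] := sF b sb.
  elim: s sF {uniqs s0 sb} => [|y s IHs] sF; first by exists X0.
  have [b' sb'|X FX sX] := IHs; first by apply: sF; rewrite inE sb' orbT.
  have [Y FY Yy] := sF y (mem_head _ _).
  have [XY|YX] := totF X Y FX FY.
    by exists Y => // z; rewrite inE => /orP[/eqP->|/sX/XY].
  by exists X => // z; rewrite inE => /orP[/eqP->|/sX] //; apply: YX.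
exists (fun x => `[< B x >]); split=> [x|s c uniqs sB]; last first.
  by apply: indepB => // b /sB/asboolP.
have [Bx|B'x] := pselect (B x).
  exists [:: x], (fun=> 1); rewrite big_seq1 scale1r; split=> // b.
  by rewrite inE => /eqP->; apply/asboolP.
have /existsNP[s /existsNP[c]] : ~ indep (B `|` [set x])%classic.
  apply: maxB; rewrite properEneq; split; last by move=> b; left.
  by apply/eqP => BE; apply: B'x; rewrite BE; right.
move=> /not_implyP[uniqs /not_implyP[sB /not_implyP[s0]]].
move=> /existsNP[b /not_implyP[sb cb]].
have sBx y : y \in s -> y != x -> B y by move=> /sB[|->] //; rewrite eqxx.
have sx : x \in s.
  apply: contrapT => /negP s'x; apply: cb; apply: indepB s0 b sb => // y sy.
  by apply: sBx => //; apply: contraNneq s'x => <-.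
have cx : c x != 0.
  apply/eqP => cx0; apply: cb; have [-> //|bx] := eqVneq b x.
  apply: (indepB (rem x s) c); rewrite ?rem_uniq // ?mem_rem_uniq ?inE ?bx //.
    by move=> y; rewrite mem_rem_uniq // inE => /andP[yx sy]; apply: sBx.
  by move: s0; rewrite (big_rem x) //= cx0 scale0r add0r.
exists (rem x s), (fun b => - (c x)^-1 * c b); split.
  by move=> y; rewrite mem_rem_uniq // inE => /andP[yx sy]; apply/asboolP/sBx.
move: s0; rewrite (big_rem x) //= => /eqP; rewrite addr_eq0 => /eqP cxx.
under eq_bigr => y _ do rewrite -scalerA.
by rewrite -scaler_sumr scaleNr -scalerN -cxx scalerA mulVf // scale1r.
Qed.

Section BaseChangeFree.
Context (R S : comNzRingType) (iota : {rmorphism R -> S}) (M : lmodType R).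
Context (W0 : submodClosed M).

(** The vectors b (x) 1, for b in a basis of W0, form a basis.  A relation
    between them is a relation in M (x) S; each functional on S contracts it to
    a relation between the vectors b, so the functionals kill its coefficients,
    and by assumption they separate the points of S. *)
Lemma base_change_free :
    free_module (submod W0) ->
    (forall a, (forall l, scalar_linear iota idfun l -> l a = 0) -> a = 0) ->
  free_module (submod (base_change iota W0 : submodClosed _)).
Proof.
move=> [B [genB freeB]] sepS; set N := submod _.
pose j (x : submod W0) : N := Submod (tens_base_change iota 1 (valP x)).
exists (fun w => `[< exists2 b, b \in B & w = j b >]); split=> [w|s c].
  have [r rB ->] : exists2 r : seq (S * N),
      {in r, forall ab, exists2 b, b \in B & ab.2 = j b} &
      w = \sum_(ab <- r) ab.1 *: ab.2.
    have /base_changeP[s sW0 wE] := valP w.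
    suff [r rB rE] : exists2 r : seq (S * N),
        {in r, forall ab, exists2 b, b \in B & ab.2 = j b} &
        val w = \sum_(ab <- r) ab.1 *: val ab.2.
      by exists r => //; apply: val_inj; rewrite rE linear_sum.
    rewrite wE; elim: s sW0 {w wE} => [|[x a] s IHs] sW0.
      by exists [::]; rewrite ?big_nil.
    have [xa s_xa|r rB rE] := IHs; first by apply: sW0; rewrite inE s_xa orbT.
    have W0x : x \in W0 by apply: (sW0 (x, a)); rewrite mem_head.
    have [t [c [tB xE]]] := genB (Submod W0x).
    exists ([seq (iota (c b) * a, j b) | b <- t] ++ r).
      move=> ab; rewrite mem_cat => /orP[/mapP[b tb ->]|/rB //].
      by exists b => //; apply: tB.
    rewrite big_cons big_cat big_map -rE /=; congr (_ + _).
    have -> : x = \sum_(b <- t) c b *: val b.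
      by rewrite -[x]/(val (Submod W0x)) xE linear_sum.
    rewrite tens_suml; apply: eq_bigr => b _.
    by rewrite tensorZl tensorZr mulr1.
  exists (undup (unzip2 r)), (fun b => \sum_(ab <- r | ab.2 == b) ab.1).
  split; last exact: sum_gather.
  move=> _ /[!mem_undup]/mapP[ab r_ab ->]; apply/asboolP.
  exact: rB r_ab.
move=> uniqs sB s0.
have [t tB sE] : exists2 t, {subset t <= B} & s = map j t.
  elim: s sB {uniqs s0} => [|w s IHs] sB; first by exists [::].
  have [b sb|t tB ->] := IHs; first by apply: sB; rewrite inE sb orbT.
  have /asboolP[b Bb ->] := sB w (mem_head _ _).
  by exists (b :: t) => // b'; rewrite inE => /orP[/eqP->|/tB].
rewrite {}sE in uniqs s0 sB *; move=> _ /mapP[b tb ->].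
apply: sepS => l linl.
apply: (freeB t (fun b => l (c (j b)))) => //; first exact: map_uniq uniqs.
apply: val_inj; rewrite linear_sum linear0.
have := congr1 (fun w : N => slice l (val w)) s0.
rewrite big_map linear_sum linear0.
under eq_bigr => x _ do rewrite linearZ /= tensorZr mulr1.
rewrite -(big_map (fun x => (val x, c (j x))) xpredT
  (fun xa => tens iota xa.1 xa.2)) slice_sum // big_map.
rewrite -[X in slice l X](big_nil 0 +%R xpredT (fun xa => tens iota xa.1 xa.2)).
rewrite slice_sum // big_nil => sum0; apply: etrans sum0.
by apply: eq_bigr => x _; rewrite linearZ.
Qed.

End BaseChangeFree.

(** * Truncated polynomials *)

Section TruncTheory.
Context (R : comNzRingType) (p : nat).
Implicit Types (f g : trunc R p).

Lemma in_qpolyK f : in_qpoly 'X^p (f : {poly R}) = f.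
Proof. by apply/val_inj/in_qpoly_small/size_mk_monic. Qed.

Lemma coef_in_qpoly (u : {poly R}) i : (i < p)%N -> (in_qpoly 'X^p u)`_i = u`_i.
Proof.
case: p => // n lt_in; rewrite /in_qpoly /= mk_monic_Xn.
rewrite [in RHS](Pdiv.RingMonic.rdivp_eq (monicXn R n.+1) u).
by rewrite coefD coefMXn lt_in add0r.
Qed.

Lemma trunc_coef0_eq0 f :
  trunc_coef0 p f = 0 -> exists g : trunc R p, f = 'qX * g.
Proof.
move=> f0; have /factor_theorem[q fq] : root (f : {poly R}) 0.
  by rewrite /root horner_coef0 -/(trunc_coef0 p f) f0.
exists (in_qpoly _ q); rewrite -in_qpolyM -[LHS]in_qpolyK fq subr0.
by rewrite mulrC.
Qed.

Lemma trunc_coef0X : trunc_coef0 p (qpolyX 'X^p : trunc R p) = 0.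
Proof. by rewrite /trunc_coef0 /= coef0_rmodp_Xn coefX. Qed.

Definition trunc_coef1 f : R := (f : {poly R})`_1.

(** For p = 1 the element X is zero. *)
Lemma trunc_coef1_qX f : (1 < p)%N -> trunc_coef1 ('qX * f) = trunc_coef0 p f.
Proof.
move=> p_gt1; rewrite -[f in LHS]in_qpolyK -in_qpolyM /trunc_coef1.
by rewrite coef_in_qpoly // coefXM.
Qed.

Lemma trunc_coef1C a : trunc_coef1 (qpolyC _ a) = 0.
Proof. by rewrite /trunc_coef1 /= coefC. Qed.

Lemma trunc_coef1D f g : trunc_coef1 (f + g) = trunc_coef1 f + trunc_coef1 g.
Proof. by rewrite /trunc_coef1 /= coefD. Qed.

Lemma coef_qpolyC_mul a f i :
  (qpolyC _ a * f : {poly R})`_i = a * (f : {poly R})`_i.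
Proof.
rewrite poly_of_qpolyM /= mul_polyC Pdiv.CommonRing.rmodp_small ?coefZ //.
by apply: leq_ltn_trans (size_scale_leq _ _) (size_mk_monic _).
Qed.

Lemma trunc_decomp f :
  exists g : trunc R p, f = qpolyC _ (trunc_coef0 p f) + 'qX * g.
Proof.
have [|g fg] := trunc_coef0_eq0 (f := f - qpolyC _ (trunc_coef0 p f)).
  by rewrite rmorphB /= trunc_coef0C subrr.
by exists g; rewrite -fg addrC subrK.
Qed.

Lemma qX_expp : (0 < p)%N -> 'qX ^+ p = 0 :> trunc R p.
Proof.
case: p => // n _; rewrite -rmorphXn /=; apply: val_inj => /=.
by rewrite mk_monic_Xn Pdiv.RingMonic.rmodpp // monicXn.
Qed.

Lemma qX_exp_mul_eq0 k g : (k < p)%N -> 'qX ^+ k * g = 0 -> trunc_coef0 p g = 0.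
Proof.
move=> lt_kp; rewrite -[g in LHS]in_qpolyK -rmorphXn -rmorphM /=.
move=> /(congr1 (fun f : trunc R p => (f : {poly R})`_k)).
by rewrite coef_in_qpoly // coefXnM ltnn subnn coef0.
Qed.

End TruncTheory.

Lemma trunc_separated (p : nat) (K : fieldType) (L : fieldExtType K)
    (f : trunc L p) :
  (forall l, scalar_linear (toLX p L) idfun l -> l f = 0) -> f = 0.
Proof.
move=> lf0; apply: val_inj; apply/polyP => i; rewrite coef0.
rewrite (coord_vbasis (memvf (val f)`_i)) big1 // => j _.
rewrite (lf0 (fun f => coord (vbasis {:L}) j (f : {poly L})`_i)) ?scale0r //.
split=> [a b|r a]; first by rewrite /= coefD linearD.
by rewrite coef_qpolyC_mul mulr_algl linearZ.
Qed.

(** * Reduction modulo X *)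

Section QuotientTensor.
Context (R S : comNzRingType) (phi : {rmorphism R -> S}) (N : lmodType R).
Context (phi_section : {additive S -> R}) (phiK : cancel phi_section phi).
Implicit Types (x : N) (a : S).

(** Scalars lift along the section of phi, and the lifts pass across the
    tensor sign. *)
Lemma tensor_quotient_pure (t : tensor phi N) : exists x, t = tens phi x 1.
Proof.
have [s ->] := tensorP t; exists (\sum_(xa <- s) phi_section xa.2 *: xa.1).
rewrite tens_suml; apply: eq_bigr => xa _.
by rewrite tensorZl mulr1 phiK.
Qed.

(** The kernel of N -> N (x) S is c N when the kernel of phi is generated by c.
    Lifting the coefficients by the section of phi gives a value in N to each
    formal sum of tensors, and each defining relation of the tensor product
    preserves that value modulo c N. *)
Lemma tensor_quotient_eq0 (c : R) x :
    (forall r, phi r = 0 -> exists q, r = c * q) ->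
  tens phi x 1 = 0 -> exists y, x = c *: y.
Proof.
move=> kerphi.
pose lift (s : seq (N * S)) := \sum_(xa <- s) phi_section xa.2 *: xa.1.
have liftP s t : tensor_rel phi s t -> exists y, lift s - lift t = c *: y.
  have lift_same u v : lift u = lift v -> exists y, lift u - lift v = c *: y.
    by move=> ->; exists 0; rewrite scaler0 subrr.
  elim=> {s t}.
  - by move=> s; apply: lift_same.
  - by move=> s t _ [y sty]; exists (- y); rewrite scalerN -sty opprB.
  - move=> s t u _ [y sty] _ [z tuz]; exists (y + z).
    by rewrite scalerDr -sty -tuz addrA subrK.
  - move=> s s' t t' _ [y ssy] _ [z ttz]; exists (y + z).
    by rewrite scalerDr -ssy -ttz /lift !big_cat /= opprD addrACA.
  - by move=> s t; apply: lift_same; rewrite /lift !big_cat /= addrC.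
  - by move=> a; apply: lift_same; rewrite /lift big_seq1 big_nil scaler0.
  - move=> y z a; apply: lift_same.
    by rewrite /lift big_seq1 big_cons big_seq1 scalerDr.
  - move=> y a b; apply: lift_same.
    by rewrite /lift big_seq1 big_cons big_seq1 raddfD scalerDl.
  - move=> r y a; rewrite /lift !big_seq1 /= scalerA -scalerBl.
    case: (kerphi (phi_section a * r - phi_section (phi r * a))) => [|q ->].
      by rewrite rmorphB rmorphM /= !phiK mulrC subrr.
    by exists (q *: y); rewrite scalerA.
have lift_x1 : exists y, x = phi_section 1 *: x + c *: y.
  case: (kerphi (1 - phi_section 1)) => [|q q1].
    by rewrite rmorphB rmorph1 phiK subrr.
  by exists (q *: x); rewrite scalerA -q1 -scalerDl addrC subrK scale1r.
move=> /eq_tensor/liftP[y]; have [z xz] := lift_x1.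
rewrite /lift big_seq1 big_nil subr0 /= => x1y.
by exists (y + z); rewrite scalerDr -x1y.
Qed.

End QuotientTensor.

Section Reduction.
Context (p : nat) (K : fieldType) (L : fieldExtType K) (V : lmodType K).
Context (Wt : submodClosed (ext_LX p L V)).

Lemma trunc_coef0_toLX r : trunc_coef0 p (toLX p L r) = toL L r.
Proof. exact: trunc_coef0C. Qed.

(** The map V_{L[X]/(X^p)} -> V_L given by X = 0. *)
Definition special_fibre : ext_LX p L V -> ext_L L V :=
  tensor_mapr (toL L) (trunc_coef0 p).

Lemma scalar_linear_coef0 : scalar_linear (toLX p L) (toL L) (trunc_coef0 p).
Proof. exact/scalar_linear_rmorphism/trunc_coef0_toLX. Qed.

Lemma scalar_linear_coef1 : scalar_linear (toLX p L) (toL L) (@trunc_coef1 L p).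
Proof.
by split=> [f g|r f]; rewrite ?trunc_coef1D //; apply: coef_qpolyC_mul.
Qed.

Lemma reduction_tens (w : submod Wt) a :
  reduction (tens (trunc_coef0 p) w a) = a *: special_fibre (val w).
Proof.
rewrite /reduction /tensor_mapl tensor_lift_tens; last exact: balanced_mapl.
rewrite /tensor_assoc tensor_lift_tens //.
exact/balanced_assoc/trunc_coef0_toLX.
Qed.

Lemma reductionD t u :
  reduction (Wt := Wt) (t + u) = reduction t + reduction u.
Proof.
rewrite /reduction [tensor_mapl _ _]tensor_liftD; last exact: balanced_mapl.
by rewrite [LHS]tensor_liftD //; apply/balanced_assoc/trunc_coef0_toLX.
Qed.

(** Since Wt (x) L = Wt / X Wt, surjectivity of the reduction onto W says that W
    is the special fibre of Wt, and injectivity says that X Wt contains the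
    elements of Wt with zero special fibre. *)
Lemma identifies_reductionP (W : {pred ext_L L V}) :
  identifies (reduction (Wt := Wt)) W <->
  (forall y, y \in W <-> exists2 w, w \in Wt & special_fibre w = y) /\
  (forall w, w \in Wt -> special_fibre w = 0 ->
     exists2 u, u \in Wt & w = 'qX *: u).
Proof.
have surj := @tensor_quotient_pure _ _ (trunc_coef0 p) (submod Wt)
  (@qpolyC L 'X^p) (@trunc_coef0C L p).
have reduction0 : reduction (Wt := Wt) 0 = 0.
  by apply: (addrI (reduction (Wt := Wt) 0)); rewrite -reductionD !addr0.
split=> [[injW imW]|[imW kerW]]; split.
- move=> y; rewrite imW; split=> [[t <-]|[w Ww <-]].
    have [w ->] := surj t; exists (val w); first exact: (valP w).
    by rewrite reduction_tens scale1r.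
  by exists (tens _ (Submod Ww) 1); rewrite reduction_tens scale1r.
- move=> w Ww w0; pose w' := Submod Ww.
  have w1 : tens (trunc_coef0 p) w' 1 = 0.
    by apply: injW; rewrite reduction0 reduction_tens scale1r.
  have [u wu] :=
    tensor_quotient_eq0 (@trunc_coef0C L p) (@trunc_coef0_eq0 L p) w1.
  by exists (val u); [apply: (valP u) | rewrite -[w]/(val w') wu linearZ].
- move=> t u tu; apply/eqP; rewrite -subr_eq0; apply/eqP.
  have [w tuw] := surj (t - u); have : special_fibre (val w) = 0.
    rewrite -[special_fibre _]scale1r -reduction_tens -tuw.
    apply: (addIr (reduction (Wt := Wt) u)).
    by rewrite -reductionD subrK add0r.
  case/(kerW _ (valP w)) => z Wz wz; rewrite tuw.
  rewrite (_ : w = 'qX *: Submod Wz); last by apply: val_inj; rewrite linearZ.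
  rewrite tensorZl /= trunc_coef0X mul0r.
  exact: tens0r.
- move=> y; rewrite imW; split=> [[w Ww <-]|[t <-]].
    by exists (tens _ (Submod Ww) 1); rewrite reduction_tens scale1r.
  have [w ->] := surj t; exists (val w); first exact: (valP w).
  by rewrite reduction_tens scale1r.
Qed.
End Reduction.

(** * Descent along operators *)

Section Descent.
Context (K : fieldType) (L : fieldExtType K) (V : lmodType K).

Lemma scalar_linear_coord j :
  scalar_linear (toL L) idfun (fun a : L => coord (vbasis {:L}) j a).
Proof.
by split=> [a b|r a]; rewrite ?linearD //= mulr_algl linearZ.
Qed.

Lemma coord_vbasis_toL (a : L) :
  a = \sum_j toL L (coord (vbasis {:L}) j a) * (vbasis {:L})`_j.
Proof.
rewrite [LHS](coord_vbasis (memvf a)).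
by apply: eq_bigr => j _; rewrite /= mulr_algl.
Qed.

(** The injectivity of W0 (x) L -> V_L is automatic: coordinates in a basis of
    L over K commute with the inclusion of W0 in V. *)
Lemma defined_overP (W : submodClosed (ext_L L V)) :
  defined_over W <->
  exists W0 : submodClosed V,
    forall y, y \in W <-> y \in base_change (toL L) W0.
Proof.
split=> [[W0 [_ imW]]|[W0 WE]]; exists W0.
  by move=> y; rewrite imW base_change_image.
split=> [|y]; last by rewrite WE base_change_image.
move=> v w vw.
rewrite (slice_decomposition v scalar_linear_coord coord_vbasis_toL).
rewrite [RHS](slice_decomposition w scalar_linear_coord coord_vbasis_toL).
apply: eq_bigr => j _; congr (tens _ _ _); apply: val_inj => /=.
by rewrite -!slice_mapl ?vw //; apply: scalar_linear_coord.
Qed.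

(** The density theorem for L as a module over an algebra A of operators that
    contains the multiplications and whose commutant is K.  Induct on X.  If
    every operator killing the other vectors y kills x too, then with operators
    T_ y dual to these y one gets T x = sum_y T(y) c_y for T in A, where
    c_y = T_ y (x).  For T = T' \o T_ y this reads T' c_y = T'(1) c_y, so
    c_y is in K, and for T = id the formula makes x a K-combination of the
    other vectors. *)
Lemma jacobson_density (A : (L -> L) -> Prop) :
    A id -> (forall T T', A T -> A T' -> A (fun x => T x + T' x)) ->
    (forall a T, A T -> A (fun x => a * T x)) ->
    (forall T T', A T -> A T' -> A (T \o T')) ->
    (forall T, A T -> T 0 = 0) ->
    (forall x, (forall T, A T -> T x = T 1 * x) -> x \in 1%VS) ->
  forall X : seq L, free X -> forall x, x \in X ->
  exists2 T, A T & T x = 1 /\ forall y, y \in X -> y != x -> T y = 0.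
Proof.
move=> Aid Aadd Amul Acomp A0 commA X.
have [n] := ubnP (size X); elim: n => // n IHn in X *.
rewrite ltnS => leXn freeX x Xx.
pose X' := rem x X.
have permX : perm_eq X (x :: X') by apply: perm_to_rem.
have freexX' : free (x :: X') by rewrite -(perm_free permX).
have uniqX' : uniq X' by rewrite rem_uniq ?free_uniq.
have freeX' : free X' by move: freexX'; rewrite free_cons => /andP[].
have ltX'n : (size X' < n)%N by move: leXn; rewrite (perm_size permX).
have {IHn}/choice[T_ T_P] : forall y, exists T, y \in X' ->
    A T /\ (T y = 1 /\ forall z, z \in X' -> z != y -> T z = 0).
  move=> y; have [X'y|] := boolP (y \in X'); last by exists id.
  by have [T AT TP] := IHn X' ltX'n freeX' y X'y; exists T.
have AT_ y : y \in X' -> A (T_ y) by case/T_P.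
have T_y y : y \in X' -> T_ y y = 1 by case/T_P=> _ [].
have T_z y z : y \in X' -> z \in X' -> z != y -> T_ y z = 0.
  by case/T_P=> _ [_ Tyz]; apply: Tyz.
have sumT_ (a : L -> L) z : z \in X' -> \sum_(y <- X') a y * T_ y z = a z.
  move=> X'z; rewrite (bigD1_seq z) //= T_y // mulr1 big_seq_cond.
  by rewrite big1 ?addr0 // => y /andP[X'y yz]; rewrite T_z ?mulr0 // eq_sym.
apply: contrapT => noT.
(* Rescaling an operator that kills X' but not x would give the one sought. *)
have killx T : A T -> (forall y, y \in X' -> T y = 0) -> T x = 0.
  move=> AT T0; apply: contrapT => /eqP Tx; apply: noT.
  exists (fun y => (T x)^-1 * T y); first exact: Amul.
  split=> [|y]; first by rewrite mulVf.
  by rewrite (perm_mem permX) inE => /orP[->|/T0->] //; rewrite mulr0.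
(* T - sum_y T(y) T_ y is in A and kills every y in X'. *)
have Tx T : A T -> T x = \sum_(y <- X') T y * T_ y x.
  move=> AT; apply/eqP; rewrite -subr_eq0 -mulN1r; apply/eqP.
  apply: (killx (fun z => T z + -1 * \sum_(y <- X') T y * T_ y z)).
    apply: (Aadd) => //; apply: (Amul).
    elim: (X') AT_ => [|y Y IHY] AY.
      rewrite (_ : (fun _ => _) = (fun z => 0 * id z)); first exact: Amul.
      by apply/funext => z; rewrite big_nil mul0r.
    rewrite (_ : (fun _ => _) =
      (fun z => T y * T_ y z + \sum_(y <- Y) T y * T_ y z)).
      apply: (Aadd); first by apply/Amul/AY; rewrite mem_head.
      by apply: IHY => z Yz; apply: AY; rewrite inE Yz orbT.
    by apply/funext => z; rewrite big_cons.
  by move=> z X'z; rewrite sumT_ // mulN1r subrr.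
(* In the formula for T \o T_ y only the term of y survives, as T \o T_ y maps
   y to T 1 and the other vectors of X' to T 0 = 0. *)
have T_x y : y \in X' -> T_ y x \in 1%VS.
  move=> X'y; apply: commA => T AT.
  have := Tx _ (Acomp _ _ AT (AT_ y X'y)); rewrite /= => ->.
  rewrite (bigD1_seq y) //= T_y // big_seq_cond big1 ?addr0 //.
  by move=> z /andP[X'z zy]; rewrite T_z // A0 ?mul0r.
move: freexX'; rewrite free_cons => /andP[/negP[]].
rewrite (Tx id Aid) big_seq; apply: memv_suml => y X'y.
have /vlineP[k ->] := T_x y X'y.
by rewrite mulrC mulr_algl memvZ // memv_span.
Qed.

Definition rational_part (W : submodClosed (ext_L L V)) : {pred V} :=
  fun x => tens (toL L) x 1 \in W.

Lemma mem_rational_part (W : submodClosed (ext_L L V)) x :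
  (x \in rational_part W) = (tens (toL L) x 1 \in W).
Proof. by []. Qed.

Fact rational_part_submod_closed (W : submodClosed (ext_L L V)) :
  submod_closed (rational_part W).
Proof.
split=> [|k x y]; rewrite !mem_rational_part.
  by rewrite tens0l rpred0.
by move=> Wx Wy; rewrite tensorDl tensorZl -tensorZr rpredD // rpredZ.
Qed.

HB.instance Definition _ (W : submodClosed (ext_L L V)) :=
  GRing.isSubmodClosed.Build K V (rational_part W)
    (rational_part_submod_closed W).

Definition stable (W : {pred ext_L L V}) (T : L -> L) : Prop :=
  scalar_linear (toL L) (toL L) T /\
  forall w, w \in W -> tensor_mapr (toL L) T w \in W.

(** An operator dual to a basis vector of L maps w in W to a slice of w tensor
    1, so that all slices of w belong to the rational part of W. *)
Lemma stable_defined_over (W : submodClosed (ext_L L V)) :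
    (forall x, (forall T, stable W T -> T x = T 1 * x) -> x \in 1%VS) ->
  defined_over W.
Proof.
move=> commW; apply/defined_overP.
exists (rational_part W : submodClosed V) => w.
split=> [Ww|/base_changeP[s sW0 ->]]; last first.
  rewrite big_seq; apply: rpred_sum => xa /sW0.
  by rewrite mem_rational_part => W1; rewrite -[xa.2]mulr1 -tensorZr rpredZ.
rewrite (slice_decomposition w scalar_linear_coord coord_vbasis_toL).
apply: rpred_sum => j _; apply: tens_base_change; rewrite mem_rational_part.
have freeB : free (vbasis {:L}) := basis_free (vbasisP {:L}).
have [||||||T [linT WT] [Tj Ti]] :=
    @jacobson_density (stable W) _ _ _ _ _ commW _ freeB (vbasis {:L})`_j.
- split=> [|v Wv]; first by split.
  by have [s vE] := tensorP v; rewrite vE tensor_mapr_sum -?vE.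
- move=> T T' [linT WT] [linT' WT']; split=> [|v Wv].
    have [[TD TZ] [TD' TZ']] := (linT, linT').
    by split=> [a b|r a]; rewrite ?TD ?TD' ?TZ ?TZ' ?mulrDr // addrACA.
  by rewrite tensor_mapr_add // rpredD ?WT ?WT'.
- move=> a T [linT WT].
  have linaT := scalar_linear_comp linT (scalar_linear_mul _ a).
  split=> // v Wv.
  rewrite -(tensor_mapr_comp v linT (scalar_linear_mul _ a)).
  by rewrite -scale_tensor_mapr rpredZ ?WT.
- move=> T T' [linT WT] [linT' WT']; split=> [|v Wv].
    exact: scalar_linear_comp linT' linT.
  by rewrite -(tensor_mapr_comp v linT' linT) WT ?WT'.
- move=> T [[TD _] _].
  by apply: (addrI (T 0)); rewrite -TD !addr0.
- by rewrite mem_nth ?size_tuple.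
have := WT w Ww.
rewrite {1}(slice_decomposition w scalar_linear_coord coord_vbasis_toL).
rewrite -(big_map (fun i => (slice (fun a : L => coord (vbasis {:L}) i a) w,
  (vbasis {:L})`_i)) xpredT (fun xa => tens (toL L) xa.1 xa.2)).
rewrite tensor_mapr_sum // big_map (bigD1 j) //= Tj big1 ?addr0 // => i ij.
rewrite Ti ?mem_nth ?size_tuple //; last first.
  by rewrite nth_uniq ?size_tuple // free_uniq.
exact: tens0r.
Qed.

End Descent.

(** * Automorphisms of L[X]/(X^p) *)

Section ExtendHG.
Context (p : nat) (p_gt0 : (0 < p)%N) (K : fieldType) (L : fieldExtType K).

(** The extension sends a polynomial f to its value at X after applying phi to
    the coefficients.  It is bijective because it induces on each quotient
    X^k / X^(k+1), identified with L, the constant term of phi. *)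
Lemma HG_extension (phi : {rmorphism L -> trunc L p}) :
    (forall k, phi (toL L k) = toLX p L k) ->
    bijective (trunc_coef0 p \o phi) ->
  exists sigma : {rmorphism trunc L p -> trunc L p},
    [/\ in_HG sigma, forall a, sigma (qpolyC _ a) = phi a & sigma 'qX = 'qX].
Proof.
move=> phiK [tau tauK phi_tau].
have commX : commr_rmorph phi ('qX : trunc L p) by move=> a; apply: mulrC.
pose ev : {rmorphism {poly L} -> trunc L p} := horner_morph commX.
have evX : ev 'X = 'qX by rewrite /= horner_morphX.
have evC a : ev a%:P = phi a by rewrite /= horner_morphC.
have ev_mod u : ev (in_qpoly 'X^p u) = ev u.
  have monic_p := monic_mk_monic ('X^p : {poly L}).
  have ev_p : ev (mk_monic 'X^p) = 0.
    by rewrite mk_monic_Xn prednK // rmorphXn evX qX_expp.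
  rewrite [in RHS](Pdiv.RingMonic.rdivp_eq monic_p u) rmorphD rmorphM.
  by rewrite ev_p mulr0 add0r.
have [sigma sigmaE] : exists sigma : {rmorphism trunc L p -> trunc L p},
    forall u, sigma (in_qpoly 'X^p u) = ev u.
  pose s (f : trunc L p) : trunc L p := ev f.
  have sB : zmod_morphism s by move=> f g; apply: (rmorphB ev).
  have sM : monoid_morphism s.
    split=> [|f g]; first exact: (rmorph1 ev).
    by rewrite /s [LHS]ev_mod; apply: (rmorphM ev).
  pose sigma : {rmorphism trunc L p -> trunc L p} := HB.pack s
    (GRing.isZmodMorphism.Build _ _ s sB)
    (GRing.isMonoidMorphism.Build _ _ s sM).
  by exists sigma.
have sigmaC a : sigma (qpolyC _ a) = phi a.
  by rewrite -evC -sigmaE -[qpolyC _ a]in_qpolyK.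
have sigmaX : sigma 'qX = 'qX by rewrite -[RHS]evX -sigmaE.
have coef0_sigma f :
    trunc_coef0 p (sigma f) = trunc_coef0 p (phi (trunc_coef0 p f)).
  have [g {1}->] := trunc_decomp f.
  by rewrite !(rmorphD, rmorphM) /= sigmaC sigmaX trunc_coef0X mul0r addr0.
have tau0 a : trunc_coef0 p (phi a) = 0 -> a = 0.
  by move=> phia0; rewrite -(tauK a) /= phia0 -[RHS]tauK /= !rmorph0.
exists sigma; split=> //; split; last first.
  move=> a; rewrite /trunc_map sigmaE -[a : {poly K}]coefK poly_def.
  rewrite !rmorph_sum; apply: eq_bigr => i _; rewrite -mul_polyC !rmorphM.
  rewrite /= !map_polyC !map_polyXn !rmorphXn evX evC; congr (_ * _).
  by rewrite phiK; apply/esym/(in_qpolyK (toLX p L a`_i)).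
have surj f : exists g, sigma g = f.
  (* Successive approximation: the error X^k h is corrected in degree k by the
     preimage of the constant term of h under the constant term of phi. *)
  have approx k : exists g h, sigma g = f + 'qX ^+ k * h.
    elim: k => [|k [g [h gh]]].
      by exists 0, (- f); rewrite mul1r subrr rmorph0.
    have [h' hE] := trunc_decomp h.
    pose c := tau (trunc_coef0 p h).
    have [h'' phic] := trunc_decomp (phi c).
    exists (g - 'qX ^+ k * qpolyC _ c), (h' - h'').
    rewrite rmorphB rmorphM rmorphXn sigmaX /= sigmaC gh {1}hE phic.
    rewrite -/((trunc_coef0 p \o phi) c) phi_tau.
    by rewrite exprSr -!mulrA -addrA -mulrBr opprD addrACA subrr add0r -mulrBr.
  by have [g [h gh]] := approx p; exists g; rewrite gh qX_expp // mul0r addr0.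
have inj f : sigma f = 0 -> f = 0.
  move=> sf0.
  have divX k : (k <= p)%N -> exists g, f = 'qX ^+ k * g; last first.
    by have [//|g ->] := divX p; rewrite qX_expp ?mul0r.
  elim: k => [_|k IHk lt_kp]; first by exists f; rewrite mul1r.
  have [g fg] := IHk (ltnW lt_kp).
  move: sf0; rewrite fg rmorphM rmorphXn sigmaX => /(qX_exp_mul_eq0 lt_kp).
  rewrite coef0_sigma => /tau0; have [g' {2}->] := trunc_decomp g.
  by move=> ->; exists g'; rewrite qpolyC0 add0r mulrA -exprSr.
have /choice[inv invP] := surj; exists inv => f; last exact: invP.
by apply/eqP; rewrite -subr_eq0; apply/eqP/inj; rewrite rmorphB invP subrr.
Qed.

End ExtendHG.

Section Stability.
Context (p : nat) (p_gt1 : (1 < p)%N) (K : fieldType) (L : fieldExtType K).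
Context (V : lmodType K) (Wt : submodClosed (ext_LX p L V)).
Context (W : submodClosed (ext_L L V)).
Context (WtHG : HG_invariant Wt) (WtW : identifies (reduction (Wt := Wt)) W).

Lemma HG_toLX (sigma : {rmorphism trunc L p -> trunc L p}) r :
  in_HG sigma -> sigma (toLX p L r) = toLX p L r.
Proof.
move=> [_ /(_ (qpolyC _ r))].
suff -> : trunc_map (in_alg L) (qpolyC _ r) = toLX p L r by [].
by rewrite /trunc_map /= map_polyC; apply: (in_qpolyK (toLX p L r)).
Qed.

(** The automorphism of L[X]/(X^p) acting by s on coefficients induces
    id (x) s on the special fibre. *)
Lemma stable_automorphism (s : {rmorphism L -> L}) :
  bijective s -> (forall k, s (toL L k) = toL L k) -> stable W s.
Proof.
move=> bij_s sK; have lins := scalar_linear_rmorphism sK.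
have p_gt0 := ltnW p_gt1.
pose phi : {rmorphism L -> trunc L p} := qpolyC 'X^p \o s.
have coef0phi : trunc_coef0 p \o phi =1 s by move=> a; apply: trunc_coef0C.
have [||sigma [HGsigma sigmaC sigmaX]] := @HG_extension p p_gt0 K L phi.
- by move=> k; rewrite /= sK.
- exact: (eq_bij bij_s (fsym coef0phi)).
have [imW _] := (identifies_reductionP Wt W).1 WtW.
split=> // w /imW[v Wtv <-]; apply/imW.
exists (HG_act sigma v); first exact: WtHG.
have linsigma := scalar_linear_rmorphism (fun r => HG_toLX r HGsigma).
have lin0 := scalar_linear_coef0 p L.
rewrite /special_fibre /HG_act !tensor_mapr_comp //.
apply: eq_tensor_mapr => f /=.
have [g {1}->] := trunc_decomp f.
rewrite !(rmorphD, rmorphM) /= sigmaC sigmaX trunc_coef0X mul0r addr0.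
exact: coef0phi.
Qed.

(** The automorphism sigma extending phi is congruent to the identity modulo X,
    so sigma - id maps Wt into X Wt; dividing by X and then setting X = 0 gives
    the action of the first-order term of phi on W. *)
Lemma stable_infinitesimal (phi : {rmorphism L -> trunc L p}) :
    (forall k, phi (toL L k) = toLX p L k) -> cancel phi (trunc_coef0 p) ->
  stable W (@trunc_coef1 L p \o phi).
Proof.
move=> phiK coef0phi; have p_gt0 := ltnW p_gt1; set D := _ \o phi.
have lin1 := scalar_linear_coef1 p L; have lin0 := scalar_linear_coef0 p L.
have linD : scalar_linear (toL L) (toL L) D.
  exact: scalar_linear_comp (scalar_linear_rmorphism phiK) lin1.
have [||sigma [HGsigma sigmaC sigmaX]] := @HG_extension p p_gt0 K L phi.
- exact: phiK.
- by exists id => a /=; rewrite ?coef0phi.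
have linsigma := scalar_linear_rmorphism (fun r => HG_toLX r HGsigma).
have coef0sigma f : trunc_coef0 p (sigma f) = trunc_coef0 p f.
  have [g {1}->] := trunc_decomp f.
  rewrite !(rmorphD, rmorphM) /= sigmaC sigmaX trunc_coef0X mul0r addr0.
  exact: coef0phi.
have coef1sigma f : trunc_coef1 (sigma f) = trunc_coef1 f + D (trunc_coef0 p f).
  have [g {1 2}->] := trunc_decomp f.
  rewrite rmorphD rmorphM sigmaC sigmaX !trunc_coef1D !trunc_coef1_qX //.
  by rewrite coef0sigma trunc_coef1C add0r addrC.
have [imW kerW] := (identifies_reductionP Wt W).1 WtW.
split=> // w /imW[v Wtv <-].
pose u := HG_act sigma v - v.
(* The special fibre of u vanishes, so u is X z; its coefficient of X is
   the special fibre of z, and also id (x) D applied to that of v. *)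
have Wtu : u \in Wt by rewrite /u -scaleN1r rpredD ?rpredZ ?WtHG.
have red_u : special_fibre u = 0.
  apply/eqP; rewrite /special_fibre /HG_act tensor_maprB // subr_eq0; apply/eqP.
  by rewrite tensor_mapr_comp //; apply: eq_tensor_mapr => f /=.
have [z Wtz uz] := kerW u Wtu red_u.
apply/imW; exists z => //.
transitivity (tensor_mapr (toL L) (@trunc_coef1 L p) u).
  have linX := scalar_linear_mul (toLX p L) 'qX.
  rewrite uz scale_tensor_mapr tensor_mapr_comp //.
  by apply: eq_tensor_mapr => f /=; rewrite trunc_coef1_qX.
rewrite tensor_maprB // /HG_act /special_fibre !tensor_mapr_comp //.
have linD0 := scalar_linear_comp lin0 linD.
apply/eqP; rewrite subr_eq addrC -tensor_mapr_add //.
by apply/eqP/eq_tensor_mapr => f /=.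
Qed.

End Stability.

(** * Elements moved by automorphisms and derivations *)

Section FieldTheory.
Context (K : fieldType) (L : fieldExtType K).

Lemma minPoly_irreducible (x : L) (f : {poly K}) :
  map_poly (in_alg L) f = minPoly 1 x -> irreducible_poly f.
Proof.
move=> fE; have szf : size f = size (minPoly 1%AS x).
  by rewrite -fE size_map_poly.
split=> [|q szq dvdq]; first by rewrite szf size_minPoly.
rewrite -(eqp_map (in_alg L)) fE.
have dvdqx : map_poly (in_alg L) q %| minPoly 1%AS x by rewrite -fE dvdp_map.
have /orP[//|] := minPoly_irr (alg_polyOver _ _) dvdqx.
by rewrite -size_poly_eq1 size_map_poly (negPf szq).
Qed.

Lemma normal_minPoly_split (normalL : normal_extension L) (x : L) :
  exists rs, minPoly 1 x = \prod_(y <- rs) ('X - y%:P).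
Proof.
have /polyOver1P[f fE] := minPolyOver 1%AS x.
have irrf : irreducible_poly f by apply: (minPoly_irreducible (x := x)).
have [|rs frs] := normalL f irrf; first by exists x; rewrite -fE root_minPoly.
exists rs; apply/eqP; rewrite -eqp_monic ?monic_minPoly ?monic_prod_XsubC //.
by rewrite [X in X %= _]fE.
Qed.

Lemma normal_splitting (normalL : normal_extension L) : SplittingField.axiom L.
Proof.
apply: normal_field_splitting => E x.
have [rs rsE] := normal_minPoly_split normalL x.
have : minPoly E x %| \prod_(y <- rs) ('X - y%:P).
  by rewrite -rsE minPolyS ?sub1v.
case/dvdp_prod_XsubC => m Em; exists (mask m rs).
by rewrite -eqp_monic ?monic_minPoly ?monic_prod_XsubC.
Qed.

(** The minimal polynomial of x has a second root y in L, and the K-embedding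
    K(x) -> L mapping x to y extends to the splitting field L. *)
Lemma separable_moved (normalL : normal_extension L) (x : L) :
    separable_element 1 x -> x \notin 1%VS ->
  exists s : {rmorphism L -> L},
    [/\ bijective s, forall k, s (toL L k) = toL L k & s x != x].
Proof.
move=> sepx K'x.
have [rs rsE] := normal_minPoly_split normalL x.
have uniq_rs : uniq rs by rewrite -separable_prod_XsubC -rsE.
have [y rsy yx] : exists2 y, y \in rs & y != x.
  apply: contrapT => noy; move: K'x; rewrite -(adjoin_deg_eq1 1%AS x).
  rewrite -eqSS -size_minPoly rsE size_prod_XsubC eqSS => /negP[].
  have : {subset rs <= [:: x]}.
    move=> y rsy; rewrite inE; apply: contrapT => yx.
    by apply: noy; exists y => //; apply/negP.
  move=> /(uniq_leq_size uniq_rs); rewrite leq_eqVlt => /orP[//|].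
  rewrite ltnS leqn0 => /nilP rs0; move: (size_minPoly 1%AS x).
  by rewrite rsE rs0 big_nil size_poly1.
have [q Kq splitq] := normal_splitting normalL.
have hom1 : kHom 1 1 (\1%VF : 'End(L)) := kHom1 1 1.
have Py : root (map_poly \1%VF (minPoly 1%AS x)) y.
  rewrite (eq_map_poly (g := id)) => [|z]; last by rewrite lfunE.
  by rewrite map_poly_id // rsE root_prod_XsubC.
have homE := kHomExtendP (subvv 1%AS) hom1 Py.
have [g homg ext_g] := kHom_extends (sub1v _) homE Kq
  (splittingFieldForS (sub1v _) (subvf _) splitq).
have /kHom_monoid_morphism gM := homg.
pose s : {rmorphism L -> L} := HB.pack (fun_of_lfun g)
  (GRing.isMonoidMorphism.Build _ _ _ gM).
exists s; split.
- have ker0 := kAutf_lker0 homg.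
  by exists (g^-1)%VF => z /=; [rewrite lker0_lfunK | rewrite lker0_lfunVK].
- by move=> k; rewrite /= linearZ /= (rmorph1 s).
- rewrite /= -ext_g ?memv_adjoin //.
  by rewrite (kHomExtend_val hom1 Py).
Qed.

End FieldTheory.

Section Inseparable.
Context (p : nat) (K : fieldType) (charK : p \in [pchar K]).
Context (L : fieldExtType K).

Let charL : p \in [pchar L]. Proof. by rewrite pchar_lalg. Qed.

Lemma inseparable_minPoly (F : {subfield L}) (x : L) :
  ~~ separable_element F x ->
  exists2 g, g \is a polyOver F & minPoly F x = g \Po 'X^p.
Proof.
case/separablePn_pchar=> q; rewrite (pcharf_eq charL) inE => /eqP-> [g].
by exists g.
Qed.

(** The morphism phi is the F-algebra map with x |-> x + X.  It is well
    defined: the minimal polynomial of x is g (X^p), and (x + X)^p = x^p in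
    characteristic p, so x + X is one of its roots. *)
Lemma inseparable_infinitesimal (F : {subfield L}) (x : L) :
    ~~ separable_element F x -> <<F; x>>%VS = fullv ->
  exists phi : {rmorphism L -> trunc L p},
    [/\ forall k, phi (toL L k) = toLX p L k, cancel phi (trunc_coef0 p)
      & trunc_coef1 (phi x) = 1].
Proof.
move=> insepx genx.
have p_gt1 : (1 < p)%N by apply/prime_gt1/(pcharf_prime charK).
have F'x : x \notin F by apply: contra insepx; apply: base_separable.
have [g Fg minE] := inseparable_minPoly insepx.
pose u : trunc L p := qpolyC _ x + 'qX.
pose C : {rmorphism L -> trunc L p} := qpolyC 'X^p.
have commu : commr_rmorph C u by move=> a; apply: mulrC.
pose ev : {rmorphism {poly L} -> trunc L p} := horner_morph commu.
have evC a : ev a%:P = qpolyC _ a by rewrite /= horner_morphC.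
have evX : ev 'X = u by rewrite /= horner_morphX.
move: ev evC evX => ev evC evX.
have up : u ^+ p = qpolyC _ (x ^+ p).
  have charT : p \in [pchar trunc L p] by rewrite pchar_qpoly.
  rewrite exprDn_pchar ?qX_expp ?(ltnW p_gt1) // ?addr0.
    by rewrite -[qpolyC _ x]/(C x) -rmorphXn.
  by rewrite pnatE ?(pcharf_prime charK).
have ev_min : ev (minPoly F x) = 0.
  transitivity (qpolyC 'X^p (minPoly F x).[x] : trunc L p); last first.
    by rewrite minPolyxx qpolyC0.
  rewrite minE comp_polyE horner_sum !rmorph_sum; apply: eq_bigr => i _.
  rewrite -mul_polyC hornerCM -exprM hornerXn !rmorphM evC !rmorphXn evX.
  by rewrite !exprM up rmorphXn.
have ev_mod h : ev (h %% minPoly F x) = ev h.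
  rewrite [in RHS](divp_eq h (minPoly F x)) rmorphD rmorphM ev_min.
  by rewrite mulr0 add0r.
have coef0ev h : trunc_coef0 p (ev h) = h.[x].
  elim/poly_ind: h => [|h c IHh]; first by rewrite !rmorph0 horner0.
  rewrite !(rmorphD, rmorphM) evX evC !hornerE !rmorphD /= IHh !trunc_coef0C.
  by rewrite trunc_coef0X addr0.
have gen y : y \in <<F; x>>%VS by rewrite genx memvf.
pose P y : {poly L} := Fadjoin_poly F x y.
have FP y : P y \is a polyOver F by apply: Fadjoin_polyOver.
have PE y : (P y).[x] = y by apply: Fadjoin_poly_eq.
pose f y := ev (P y).
have fB : zmod_morphism f by move=> y z; rewrite /f /P !raddfB.
have fC a : a \in F -> f a = qpolyC _ a.
  by move=> Fa; rewrite /f /P Fadjoin_polyC.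
have fM : monoid_morphism f.
  split=> [|y z]; first by rewrite fC ?mem1v.
  rewrite /f -rmorphM -[RHS]ev_mod -Fadjoin_poly_mod ?rpredM //.
  by rewrite hornerM !PE.
pose phi : {rmorphism L -> trunc L p} := HB.pack f
  (GRing.isZmodMorphism.Build _ _ f fB) (GRing.isMonoidMorphism.Build _ _ f fM).
exists phi; split=> [k|y|].
- by rewrite /phi /= fC // rpredZ ?mem1v.
- by rewrite /phi /= coef0ev PE.
- rewrite /phi /= /f /P Fadjoin_polyX // evX trunc_coef1D trunc_coef1C add0r.
  by rewrite -[qpolyX _]mulr1 trunc_coef1_qX // rmorph1.
Qed.

(** Take F maximal among the subfields over which x is inseparable.  Then F
    contains every y^p, as y^p is separable over K.  If y is not in F, then x is
    separable over F(y) by maximality and x^p is in F, so x is in F(y).  But x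
    has degree at least p over F and y at most p, so F(x) = F(y) contains y. *)
Lemma maximal_inseparable_subfield (x : L) :
    (forall y : L, separable_element 1 (y ^+ p)) -> ~~ separable_element 1 x ->
  exists F : {subfield L}, ~~ separable_element F x /\ <<F; x>>%VS = fullv.
Proof.
move=> sepLp insepx.
pose P n := `[< exists F : {subfield L},
  ~~ separable_element F x /\ \dim F = n >].
have exP : exists n, P n.
  by exists (\dim (1%VS : {vspace L})); apply/asboolP; exists 1%AS.
have boundP n : P n -> (n <= \dim {:L})%N.
  by move=> /asboolP[F [_ <-]]; apply/dimvS/subvf.
case: (ex_maxnP exP boundP) => n /asboolP[F [insepFx dimF]] maxn.
exists F; split=> //.
(* Adjoining y to F keeps x inseparable only if the dimension does not grow. *)
have maxF (y : L) : ~~ separable_element <<F; y>> x -> y \in F.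
  move=> insepyx; have : (\dim <<F; y>> <= \dim F)%N.
    by rewrite dimF; apply: maxn; apply/asboolP; exists <<F; y>>%AS.
  move=> ledim; have /eqP -> : F == <<F; y>>%AS :> {vspace L}.
    by rewrite eqEdim ledim subv_adjoin.
  exact: memv_adjoin.
have FLp y : y ^+ p \in F.
  apply: maxF; apply: contra insepFx; apply: adjoin_separable.
  exact: separable_elementS (sub1v F) (sepLp y).
apply/eqP; rewrite eqEsubv subvf; apply/subvP => y _.
have [Fy|F'y] := boolP (y \in F); first exact: subvP_adjoin.
have p_gt0 : (0 < p)%N by apply/prime_gt0/(pcharf_prime charK).
have Fyx : x \in <<F; y>>%VS.
  rewrite -separable_inseparable_element; apply/andP; split.
    by apply: contraR F'y; apply: maxF.
  apply/purely_inseparable_elementP_pchar; exists p.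
    by rewrite pnatE ?(pcharf_prime charK).
  exact: subvP_adjoin.
have degx : (p <= adjoin_degree F x)%N.
  have [g Fg minE] := inseparable_minPoly insepFx.
  have := size_minPoly F x; rewrite minE => /(congr1 predn)/=.
  rewrite size_comp_poly size_polyXn /= /adjoin_degree.
  by case: (size g).-1 => // d <-; apply: leq_pmull.
have degy : (adjoin_degree F y <= p)%N.
  rewrite -ltnS -size_minPoly -(size_XnsubC (y ^+ p) p_gt0).
  apply: dvdp_leq; first by rewrite -size_poly_gt0 size_XnsubC.
  apply: minPoly_dvdp; first by rewrite rpredB ?rpredX ?polyOverX ?polyOverC.
  by rewrite /root !hornerE subrr.
have eqFxy : <<F; x>>%VS = <<F; y>>%VS.
  apply/eqP; rewrite eqEdim; apply/andP; split.
    by apply/FadjoinP; rewrite subv_adjoin.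
  by rewrite !dim_Fadjoin leq_mul2r (leq_trans degy degx) orbT.
by rewrite eqFxy memv_adjoin.
Qed.

End Inseparable.

Theorem proposition4p1 (p : nat) (K : fieldType) (charK : p \in [pchar K])
    (L : fieldExtType K)
    (normalL : normal_extension L) (modularL : modular_extension L)
    (exponentL : exists2 n : nat, is_exponent p L n & (n <= 1)%N)
    (V : lmodType K) (W : submodClosed (ext_L L V)) :
  defined_over W <->
  exists Wt : submodClosed (ext_LX p L V),
    [/\ free_module (submod Wt),
        HG_invariant Wt
      & identifies (reduction (Wt := Wt)) W].
Proof.
split=> [/defined_overP[W0 WE]|[Wt [_ WtHG WtW]]].
  exists (base_change (toLX p L) W0 : submodClosed _); split.
  - exact: base_change_free (vector_space_free _) (@trunc_separated p K L).
  - move=> sigma HGsigma v; apply: base_change_mapr.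
    by apply: scalar_linear_rmorphism => r; apply: HG_toLX.
  pose C : {rmorphism L -> trunc L p} := qpolyC 'X^p.
  have linC : scalar_linear (toL L) (toLX p L) C.
    exact: scalar_linear_rmorphism.
  have lin0 := scalar_linear_coef0 p L.
  apply/identifies_reductionP; split=> [y|w].
    rewrite WE; split=> [W0y|[w Ww <-]]; last exact: base_change_mapr.
    exists (tensor_mapr (toLX p L) C y); first exact: base_change_mapr.
    rewrite /special_fibre tensor_mapr_comp // -[RHS]scale1r scale_tensor_mapr.
    by apply: eq_tensor_mapr => a; rewrite /= trunc_coef0C mul1r.
  move=> /base_changeP[s sW0 ->] red0.
  have /choice[g gE] := @trunc_decomp L p.
  exists (\sum_(xa <- s) tens (toLX p L) xa.1 (g xa.2)).
    by rewrite big_seq; apply: rpred_sum => xa /sW0; apply: tens_base_change.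
  (* Split each coefficient into its constant term and a multiple of X. *)
  transitivity (tensor_mapr (toLX p L) C
      (special_fibre (\sum_(xa <- s) tens (toLX p L) xa.1 xa.2)) +
    'qX *: \sum_(xa <- s) tens (toLX p L) xa.1 (g xa.2)).
    rewrite /special_fibre tensor_mapr_comp // tensor_mapr_sum; last first.
      exact: scalar_linear_comp lin0 linC.
    rewrite scaler_sumr -big_split; apply: eq_bigr => xa _ /=.
    by rewrite tensorZr -tensorDr -gE.
  rewrite red0; have -> : tensor_mapr (toLX p L) C (0 : ext_L L V) = 0.
    by rewrite -(subrr 0) tensor_maprB // subrr.
  by rewrite add0r.
have p_gt1 : (1 < p)%N := prime_gt1 (pcharf_prime charK).
apply: stable_defined_over => x commx; apply: contrapT => /negP K'x.
have [sepx|insepx] := boolP (separable_element 1 x).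
  have [s [bij_s sK /negP[]]] := separable_moved normalL sepx K'x.
  rewrite (commx s) ?rmorph1 ?mul1r //.
  exact: (stable_automorphism p_gt1 WtHG WtW bij_s sK).
have sepLp (y : L) : separable_element 1 (y ^+ p).
  have [n [sepn _] n_le1] := exponentL.
  case: n n_le1 sepn => [|[|//]] _ sepn; last by have := sepn y; rewrite expn1.
  by have := sepn (y ^+ p); rewrite expr1.
have [F [insepFx genFx]] := maximal_inseparable_subfield charK sepLp insepx.
have [phi [phiK coef0phi phix]] :=
  inseparable_infinitesimal charK insepFx genFx.
have /commx/eqP := stable_infinitesimal p_gt1 WtHG WtW phiK coef0phi.
rewrite /= phix rmorph1 (_ : trunc_coef1 1 = 0); last exact: trunc_coef1C.
by rewrite mul0r oner_eq0.
Qed.
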